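(* Consider either the relativistic Maxwell-Boltzmann statistics or the relativistic Bose-Einstein statistics, and let $$J^0(v)=\begin{cases}\exp\{-|v|\} & \text{for the Maxwell-Boltzmann statistics},\\[2pt] \dfrac{1}{\exp\{1+|v|\}-1} & \text{for the Bose-Einstein statistics}\end{cases}\qquad (v\in\mathbb{R}^3).$$ Let $F_0=F_0(v)$ be a nonnegative isotropic (i.e. depending on $v$ only through $|v|$) measurable function on $\mathbb{R}^3$ such that $$\int_{\mathbb{R}^3}F_0\,dv=\int_{\mathbb{R}^3}J^0\,dv,\qquad \int_{\mathbb{R}^3}|v|F_0\,dv=\int_{\mathbb{R}^3}|v|J^0\,dv .$$ Then the Cauchy problem $$\partial_tF(t,v)=J(F)(t,v)-F(t,v),\qquad F(0,v)=F_0(v)\qquad (t\ge 0,\ v\in\mathbb{R}^3),$$ where $J(F)$ is the Jüttner distribution associated with $F$ for the chosen statistics (defined in the context), is explicitly solved by $$F(t,v)=e^{-t}F_0(v)+(1-e^{-t})J^0(v).$$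
   Context: Setting: massless particles in the spatially flat FLRW spacetime with metric $\eta_{00}=-1$, $\eta_{ij}=R^2\delta_{ij}$ ($1\le i,j\le 3$), where $R=R(t)=C(t+t_0)^{1/2}$ with constants $C,t_0>0$; all physical constants are set to $1$. The variable $v\in\mathbb{R}^3$ is the spatial covariant momentum, and $v_\alpha=(v_0,v)$ with $v_0=-R^{-1}|v|$. Distribution functions $F=F(t,v)\ge 0$ are spatially homogeneous and isotropic (they depend on $v$ only through $|v|$), so the Landau-Lifshitz four-velocity is $U^\alpha=(1,0,0,0)$. Jüttner distribution. For each $t$, $J(F)(t,\cdot)$ is the function of the form $$J(F)=\exp\Big\{\frac{\mu_E}{T_E}+\frac{U_E^\alpha v_\alpha}{T_E}\Big\}\ \text{(Maxwell-Boltzmann)},\qquad J(F)=\frac{1}{\exp\{-\frac{\mu_E}{T_E}-\frac{U_E^\alpha v_\alpha}{T_E}\}-1}\ \text{(Bose-Einstein)},$$ (summation over $\alpha=0,\dots,3$), where $\mu_E\in\mathbb{R}$, $T_E>0$, and $U_E^\alpha$ is a four-velocity, i.e. $U_E^\alpha=(\sqrt{1+R^2|U_E|^2},U_E)$ with $U_E\in\mathbb{R}^3$ (all possibly depending on $t$ and on $F$, not on $v$); in the Bose-Einstein case $-\mu_E/T_E>0$ is required. The parameters are determined by the relations $$U^\alpha\int_{\mathbb{R}^3}v_\alpha(J(F)-F)\frac{1}{\sqrt{-|\eta|}}\frac{dv}{v_0}=0,\qquad U^\alpha\int_{\mathbb{R}^3}v_\alpha\eta^{\mu\beta}v_\mu(J(F)-F)\frac{1}{\sqrt{-|\eta|}}\frac{dv}{v_0}=0\quad(\beta=0,\dots,3),$$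 with $\sqrt{-|\eta|}=R^3$. Equivalently, for $U^\alpha=(1,0,0,0)$: $\int(J(F)-F)\,dv=0$, $\int|v|(J(F)-F)\,dv=0$ and $\int v\,(J(F)-F)\,dv=0$. That $F$ solves the Cauchy problem means that for every $t\ge0$ there exist parameters $\mu_E\in\mathbb{R}$, $T_E>0$ and $U_E\in\mathbb{R}^3$ with $U_E^\alpha=(\sqrt{1+R^2|U_E|^2},U_E)$ (and with $-\mu_E/T_E>0$ in the Bose-Einstein case) such that the corresponding $J(F)(t,\cdot)$ satisfies $\int_{\mathbb{R}^3}(J(F)-F)\,dv=0$, $\int_{\mathbb{R}^3}|v|(J(F)-F)\,dv=0$ and $\int_{\mathbb{R}^3}v\,(J(F)-F)\,dv=0$ with respect to $F(t,\cdot)$, and that $\partial_tF=J(F)-F$ and $F(0,\cdot)=F_0$ hold. *)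

(* Defs.v *)
From HB Require Import structures.
From mathcomp Require Import all_boot all_order all_algebra.
From mathcomp Require Import all_classical all_reals all_analysis.

Set Implicit Arguments.
Unset Strict Implicit.
Unset Printing Implicit Defensive.

Import Order.TTheory GRing.Theory Num.Theory.
Import numFieldNormedType.Exports.

Local Open Scope classical_set_scope.
Local Open Scope ring_scope.

(* [lebesgue_measure] lives on the Borel sigma-algebra; its threefold product
   is completed, so that measurability on R^3 means Lebesgue measurability. *)
Definition borel_measure3 (R : realType) : {measure set (_ * _ * _) -> \bar R} :=
  ((@lebesgue_measure R \x @lebesgue_measure R) \x @lebesgue_measure R)%E.

(* R * R * R with the sigma-algebra of Lebesgue measurable sets *)
Definition space3 (R : realType) :=
  caratheodory_type ((@borel_measure3 R)^*)%mu.

HB.instance Definition _ (R : realType) := Measurable.on (space3 R).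

Definition lebesgue_measure3 (R : realType) : {measure set (space3 R) -> \bar R} :=
  @completed_measure_extension _ _ _ (@borel_measure3 R).

Section Vectors.
Context {R : realType}.

Definition coord1 (v : space3 R) : R := v.1.1.
Definition coord2 (v : space3 R) : R := v.1.2.
Definition coord3 (v : space3 R) : R := v.2.

Definition dot3 (u v : space3 R) : R :=
  coord1 u * coord1 v + coord2 u * coord2 v + coord3 u * coord3 v.

(* The norm that the library puts on R * R * R is the sup norm. *)
Definition enorm (v : space3 R) : R := Num.sqrt (dot3 v v).

End Vectors.

Inductive statistics := Maxwell_Boltzmann | Bose_Einstein.

Section Juttner.
Context {R : realType}.
Implicit Types (s : statistics) (v U : space3 R) (f g : space3 R -> R).

Definition scale_factor (C t0 t : R) : R := C * Num.sqrt (t + t0).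

(* Below, [a] is the value at time t of the scale factor.  A massless particle
   with spatial covariant momentum v has v_0 = - |v| / a, and a four-velocity
   with spatial part U has U^0 = sqrt (1 + a^2 |U|^2). *)

Definition energy_component (a : R) v : R := - (a^-1 * enorm v).

Definition time_component (a : R) U : R :=
  Num.sqrt (1 + a ^+ 2 * enorm U ^+ 2).

(* U^alpha v_alpha, summed over alpha = 0, ..., 3 *)
Definition four_pairing (a : R) U v : R :=
  time_component a U * energy_component a v + dot3 U v.

Definition Juttner s (a mu T : R) U v : R :=
  match s with
  | Maxwell_Boltzmann => expR (mu / T + four_pairing a U v / T)
  | Bose_Einstein => (expR (- (mu / T) - four_pairing a U v / T) - 1)^-1
  end.

Definition admissible_parameters s (mu T : R) : Prop :=
  0 < T /\
  match s with
  | Maxwell_Boltzmann => True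
  | Bose_Einstein => 0 < - (mu / T)
  end.

Definition J0 s v : R :=
  match s with
  | Maxwell_Boltzmann => expR (- enorm v)
  | Bose_Einstein => (expR (1 + enorm v) - 1)^-1
  end.

Definition isotropic f : Prop := forall v w, enorm v = enorm w -> f v = f w.

Definition isotropic_distribution f : Prop :=
  [/\ measurable_fun setT f, forall v, 0 <= f v & isotropic f].

(* Integrability is required since a non-integrable integrand has a junk
   integral. *)
Definition zero_integral g : Prop :=
  (lebesgue_measure3 R).-integrable setT (EFin \o g) /\
  (\int[lebesgue_measure3 R]_v (g v)%:E = 0)%E.

Definition moment_conditions (J f : space3 R -> R) : Prop :=
  [/\ zero_integral (fun v => J v - f v),
      zero_integral (fun v => enorm v * (J v - f v)),
      zero_integral (fun v => coord1 v * (J v - f v)),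
      zero_integral (fun v => coord2 v * (J v - f v)) &
      zero_integral (fun v => coord3 v * (J v - f v))].

(* derivative at t of a function on [0, +oo[ : one-sided at t = 0 *)
Definition has_time_derivative (u : R -> R) (t l : R) : Prop :=
  (u r - u t) / (r - t) @[r --> within [set r | 0 <= r] t^'] --> l.

Definition solves_cauchy_problem s (C t0 : R) (F0 : space3 R -> R)
    (F : R -> space3 R -> R) : Prop :=
  (forall t, 0 <= t ->
    isotropic_distribution (F t) /\
    exists mu T : R, exists U : space3 R,
      let J := Juttner s (scale_factor C t0 t) mu T U in
      [/\ admissible_parameters s mu T,
          moment_conditions J (F t) &
          forall v, has_time_derivative (F ^~ v) t (J v - F t v)]) /\
  (forall v, F 0 v = F0 v).

End Juttner.

(* Main.v *)
Require Import Defs.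
From HB Require Import structures.
From mathcomp Require Import all_boot all_order all_algebra.
From mathcomp Require Import all_classical all_reals all_analysis.
From mathcomp Require Import measurable_realfun lra ring.

Set Implicit Arguments.
Unset Strict Implicit.
Unset Printing Implicit Defensive.

Import Order.TTheory GRing.Theory Num.Theory.
Import numFieldNormedType.Exports.
Local Open Scope classical_set_scope.
Local Open Scope ring_scope.

(** The point is that the Juttner distribution of the solution does not move.
For a fluid at rest (U_E = 0) with temperature T_E = 1/R(t) one has
U_E^alpha v_alpha / T_E = - |v|, and with mu_E / T_E = 0 (Maxwell-Boltzmann) or
mu_E / T_E = -1 (Bose-Einstein) the Juttner distribution is J^0 at every time
([Juttner_rest]): the redshift of the temperature is absorbed by covariant
momenta.  The equation is therefore the linear relaxation
dF/dt = J^0 - F, which the given F solves pointwise in v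
([has_time_derivative_relaxation]).

It remains to see that J^0 is the right equilibrium for F(t), that is, that the
moments of J^0 - F(t) = e^{-t} (J^0 - F_0) against 1, |v| and v vanish
([zero_integral_relaxation]).  For 1 and |v| this is the hypothesis on F_0; for
v it is the oddness of v (J^0 - F_0) under the reflection v -> - v
([integral_odd_moment]).

All these moments must also converge absolutely.  For J^0 this follows from
J^0 <= e^{-|v|}, since (1 + |v|) e^{-|v|} is dominated by a product of
one-dimensional exponentials ([weighted_exp_le],
[integral_weighted_exp_lty]).  For F_0 it follows from nonnegativity and from
the equality of its number and energy with those of J^0 ([integrable_moment]).

Since measurability is Lebesgue measurability on R^3, the reflection has to
preserve the completed product measure: invariance on the line passes to
products by uniqueness of the product measure, and to the completion because
the outer measure is computed from measurable covers, which the reflection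
permutes ([measure_preserving_prod], [measure_preserving_completion]). *)

(** * Measure-preserving maps *)

Definition measure_preserving {d} {T : measurableType d} {R : realType}
    (mu : {measure set T -> \bar R}) (phi : T -> T) : Prop :=
  measurable_fun setT phi /\
  forall A, measurable A -> mu (phi @^-1` A) = mu A.

(** Lebesgue measure is determined by its values on the intervals ]a, b], and
    their reflections [- b, - a[ have the same length. *)
Lemma measure_preservingN (R : realType) :
  measure_preserving (@lebesgue_measure R)
    (-%R : measurableTypeR R -> measurableTypeR R).
Proof.
have mN : measurable_fun [set: measurableTypeR R]
  (-%R : measurableTypeR R -> measurableTypeR R) by exact: oppr_measurable.
split=> // A mA.
pose m' := pushforward (@lebesgue_measure R)
  (-%R : measurableTypeR R -> measurableTypeR R).
have mE (X : set R) : ocitv X -> lebesgue_measure X = m' X.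
  case=> -[a b] /= _ <-; rewrite /m' /pushforward.
  have -> : -%R @^-1` `]a, b]%classic = `[- b, - a[%classic.
    by apply/seteqP; split=> x; rewrite /= !in_itv /= lerNl ltrNr andbC.
  rewrite !lebesgue_measure_itv /= !lte_fin ltrN2.
  by case: ifP => // _; rewrite opprK EFinN addrC.
exact/esym/(lebesgue_measure_unique mE).
Qed.

(** The integral over a threefold product needs the product of the first two
    factors as a bundled sigma-finite measure: the exhausting sets are the
    products of exhausting sets of the factors, taken increasing so that a
    common index can be found. *)
Section sigma_finite_product.
Context d1 d2 (T1 : measurableType d1) (T2 : measurableType d2) (R : realType).
Variables (m1 : {sigma_finite_measure set T1 -> \bar R})
  (m2 : {sigma_finite_measure set T2 -> \bar R}).

Let m12 : {measure set (T1 * T2)%type -> \bar R} := (m1 \x m2)%E.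

Lemma product_sigma_finite : sigma_finite setT m12.
Proof.
have /sigma_finiteP[F [TF ndF Foo]] := sigma_finiteT m1.
have /sigma_finiteP[G [TG ndG Goo]] := sigma_finiteT m2.
exists (fun n => F n `*` G n) => [|k].
  apply/seteqP; split=> // -[x y] _.
  have [n _ Fnx] : (\bigcup_n F n) x by rewrite -TF.
  have [k _ Gky] : (\bigcup_n G n) y by rewrite -TG.
  exists (maxn n k) => //; split => /=.
  - by move: x Fnx; exact/subsetPset/ndF/leq_maxl.
  - by move: y Gky; exact/subsetPset/ndG/leq_maxr.
have [mF Fk] := Foo k; have [mG Gk] := Goo k.
split; first exact: measurableX.
have -> : (m12 (F k `*` G k) = m1 (F k) * m2 (G k))%E.
  exact: product_measure1E.
by rewrite lte_mul_pinfty// ge0_fin_numE.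
Qed.

Definition sigma_finite_product :
    {sigma_finite_measure set (T1 * T2)%type -> \bar R} :=
  HB.pack (Measure.sort m12)
    (Measure_isSigmaFinite.Build _ _ _ m12 product_sigma_finite).

End sigma_finite_product.

(** The image of the product measure under a product of measure-preserving maps
    has the right values on rectangles, hence is the product measure. *)
Lemma measure_preserving_prod d1 d2 (T1 : measurableType d1)
    (T2 : measurableType d2) (R : realType)
    (m1 : {sigma_finite_measure set T1 -> \bar R})
    (m2 : {sigma_finite_measure set T2 -> \bar R})
    (phi1 : T1 -> T1) (phi2 : T2 -> T2) :
  measure_preserving m1 phi1 -> measure_preserving m2 phi2 ->
  measure_preserving (m1 \x m2)%E (fun z => (phi1 z.1, phi2 z.2)).
Proof.
move=> [mphi1 phi1E] [mphi2 phi2E].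
set phi := fun z : T1 * T2 => (phi1 z.1, phi2 z.2).
have mphi : measurable_fun setT phi.
  by apply: measurable_fun_pair; exact: measurableT_comp.
split=> // A mA.
apply/esym/(product_measure_unique (m' := pushforward (m1 \x m2)%E phi)) => //.
move=> A1 A2 mA1 mA2; rewrite /pushforward.
have mp1 : measurable (phi1 @^-1` A1).
  by rewrite -[X in measurable X]setTI; exact: mphi1.
have mp2 : measurable (phi2 @^-1` A2).
  by rewrite -[X in measurable X]setTI; exact: mphi2.
rewrite -[LHS]/((m1 \x m2)%E ((phi1 @^-1` A1) `*` (phi2 @^-1` A2))).
by rewrite product_measure1E// phi1E// phi2E.
Qed.

Lemma ge0_integral_preserving d (T : measurableType d) (R : realType)
    (mu : {measure set T -> \bar R}) (phi : T -> T) (f : T -> \bar R) :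
  measure_preserving mu phi -> measurable_fun setT f ->
  (forall x, 0 <= f x)%E -> (\int[mu]_x f (phi x) = \int[mu]_x f x)%E.
Proof.
move=> [mphi phiE] mf f0.
transitivity (\int[pushforward mu phi]_x f x)%E.
  by rewrite (ge0_integral_pushforward mphi).
by apply: eq_measure_integral => A mA _; exact: phiE.
Qed.

Section completed_measure.
Context d (T : measurableType d) (R : realType) (mu : {measure set T -> \bar R}).

Let cT : measurableType _ := caratheodory_type (mu^*)%mu.
Let cmu : {measure set cT -> \bar R} := @completed_measure_extension _ _ _ mu.

Lemma measurable_completion_id : measurable_fun [set: cT] (id : cT -> T).
Proof.
move=> _ Y mY; rewrite setTI.
exact: caratheodory_measurable_mu_ext.
Qed.

(** The identity is measurable from the completion to the original space and
    maps the completed measure to [mu]; the integral of a function measurable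
    before completion can thus be computed there, e.g. by Tonelli. *)
Lemma ge0_integral_completion (f : T -> \bar R) :
  measurable_fun setT f -> (forall x, 0 <= f x)%E ->
  (\int[cmu]_x f x = \int[mu]_x f x)%E.
Proof.
move=> mf f0; have mid := measurable_completion_id.
transitivity (\int[pushforward cmu (id : cT -> T)]_x f x)%E.
  by rewrite (ge0_integral_pushforward mid).
apply: eq_measure_integral => A mA _.
by rewrite -[LHS]/((mu^*)%mu A) measurable_mu_extE.
Qed.

Section involution.
Variable phi : T -> T.
Hypotheses (phiK : involutive phi) (phi_mu : measure_preserving mu phi).

Let phi_preimageK (X : set T) : phi @^-1` (phi @^-1` X) = X.
Proof. by apply/seteqP; split=> x /=; rewrite phiK. Qed.

(** The preimages of a measurable cover of [X] form a measurable cover of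
    [phi @^-1` X] with the same total mass; being an involution, [phi] also
    carries covers back, which gives the converse inequality. *)
Lemma mu_ext_preimage (X : set T) : (mu^* (phi @^-1` X) = mu^* X)%mu.
Proof.
have [mphi phiE] := phi_mu.
suff le X' : (mu^* (phi @^-1` X')%classic <= mu^* X')%E%mu.
  by apply/eqP; rewrite eq_le le -{1}(phi_preimageK X) le.
apply: le_ereal_inf_tmp => _ [A [mA XA] <-].
apply: ereal_inf_lbound; exists (fun k => phi @^-1` A k); first split.
- by move=> k; rewrite -[X in measurable X]setTI; exact: mphi.
- by move=> x /XA [k _ Ak]; exists k.
- by apply: eq_eseriesr => k _; rewrite phiE.
Qed.

(** Caratheodory measurability is stated through the outer measure alone, so
    it is preserved together with the outer measure. *)
Lemma measure_preserving_completion :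
  measure_preserving cmu (phi : cT -> cT).
Proof.
split=> [_ A cA|A _]; last exact: mu_ext_preimage.
have {}cA : (caratheodory_measurable mu^* A)%mu := cA.
suff cphiA : (caratheodory_measurable mu^* (phi @^-1` A))%mu by rewrite setTI.
move=> X.
have phiI (Y : set T) : phi @^-1` X `&` Y = phi @^-1` (X `&` phi @^-1` Y).
  by rewrite -{1}(phi_preimageK Y).
rewrite -(mu_ext_preimage X) (cA (phi @^-1` X)) (phiI A) (phiI (~` A)).
by rewrite (mu_ext_preimage (X `&` _)) (mu_ext_preimage (X `&` ~` _)).
Qed.

End involution.
End completed_measure.

(** The change of variables [phi] shows that the integral equals its own
    opposite; finiteness then forces it to vanish. *)
Lemma integral_odd d (T : measurableType d) (R : realType)
    (mu : {measure set T -> \bar R}) (phi : T -> T) (f : T -> R) :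
  measure_preserving mu phi -> (forall x, f (phi x) = - f x) ->
  mu.-integrable setT (EFin \o f) -> (\int[mu]_x (f x)%:E = 0)%E.
Proof.
move=> [mphi phiE] f_odd fi.
have oppi : mu.-integrable setT ((EFin \o f) \o phi).
  rewrite (_ : _ \o _ = (fun x => - (EFin \o f) x)%E); first exact: integrableN.
  by apply/funext => x /=; rewrite f_odd EFinN.
have mf : measurable_fun setT (EFin \o f) by case/integrableP: fi.
have : (\int[mu]_x (f x)%:E = - \int[mu]_x (f x)%:E)%E.
  transitivity (\int[pushforward mu phi]_x (f x)%:E)%E.
    by apply/esym/eq_measure_integral => A mA _; exact: phiE.
  rewrite (integral_pushforward mphi mf oppi)//= -integralN/=; last first.
    exact: integrable_add_def.
  by apply: eq_integral => x _; rewrite f_odd EFinN.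
have := integrable_fin_num measurableT fi.
rewrite /comp; case: (\int[mu]_x (f x)%:E)%E => // r _ /eqP.
by rewrite -EFinN eqe -subr_eq0 opprK -mulr2n mulrn_eq0/= => /eqP ->.
Qed.

(** * Integrals over products *)

Lemma ge0_integral_tensor d1 d2 (T1 : measurableType d1)
    (T2 : measurableType d2) (R : realType)
    (m1 : {sigma_finite_measure set T1 -> \bar R})
    (m2 : {sigma_finite_measure set T2 -> \bar R})
    (f : T1 -> \bar R) (g : T2 -> \bar R) :
  measurable_fun setT f -> measurable_fun setT g ->
  (forall x, 0 <= f x)%E -> (forall y, 0 <= g y)%E ->
  (\int[m1 \x m2]_z (f z.1 * g z.2) =
   \int[m1]_x f x * \int[m2]_y g y)%E.
Proof.
move=> mf mg f0 g0.
have mfst : measurable_fun setT (f \o @fst T1 T2) by exact: measurableT_comp.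
have msnd : measurable_fun setT (g \o @snd T1 T2) by exact: measurableT_comp.
rewrite fubini_tonelli1/=; first last.
- by move=> z; exact: mule_ge0.
- exact: emeasurable_funM.
rewrite -ge0_integralZr//; last exact: integral_ge0.
by apply: eq_integral => x _; rewrite /fubini_F/= ge0_integralZl.
Qed.

Lemma ge0_integral_tensor3 d1 d2 d3 (T1 : measurableType d1)
    (T2 : measurableType d2) (T3 : measurableType d3) (R : realType)
    (m1 : {sigma_finite_measure set T1 -> \bar R})
    (m2 : {sigma_finite_measure set T2 -> \bar R})
    (m3 : {sigma_finite_measure set T3 -> \bar R})
    (f : T1 -> \bar R) (g : T2 -> \bar R) (h : T3 -> \bar R) :
  measurable_fun setT f -> measurable_fun setT g -> measurable_fun setT h ->
  (forall x, 0 <= f x)%E -> (forall y, 0 <= g y)%E ->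
  (forall z, 0 <= h z)%E ->
  (\int[(m1 \x m2) \x m3]_z (f z.1.1 * g z.1.2 * h z.2) =
   \int[m1]_x f x * \int[m2]_y g y * \int[m3]_z h z)%E.
Proof.
move=> mf mg mh f0 g0 h0.
rewrite -(ge0_integral_tensor m1 m2 mf mg f0 g0).
have mfg : measurable_fun setT (fun z : T1 * T2 => f z.1 * g z.2)%E.
  by apply: emeasurable_funM; exact: measurableT_comp.
have fg0 (z : T1 * T2) : (0 <= f z.1 * g z.2)%E by exact: mule_ge0.
exact: (ge0_integral_tensor (sigma_finite_product m1 m2) m3 mfg mh fg0 h0).
Qed.

Lemma measurable_expR_abs (R : realType) (c : R) :
  measurable_fun [set: measurableTypeR R] (fun x => expR (- (c * `|x|))).
Proof.
apply: (@continuous_measurable_fun R (fun x => expR (- (c * `|x|)))) => x.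
apply: continuous_comp; last exact: continuous_expR.
by apply: cvgN; apply: cvgM; [exact: cvg_cst|exact: norm_continuous].
Qed.

(** Up to the factor [c], the function is dominated by the density of the
    exponential law plus its mirror image, and both have total mass one. *)
Lemma integral_expR_abs_lty (R : realType) (c : R) : 0 < c ->
  (\int[@lebesgue_measure R]_x (expR (- (c * `|x|)))%:E < +oo)%E.
Proof.
move=> c0.
have mexp := @measurable_expR_abs R c.
pose p : measurableTypeR R -> R := exponential_pdf c.
have mp : measurable_fun setT (EFin \o p).
  by apply/measurable_EFinP; exact: measurable_exponential_pdf.
have p0 x : (0 <= (EFin \o p) x)%E.
  by rewrite lee_fin exponential_pdf_ge0// ltW.
have mpN : measurable_fun setT
    (fun x : measurableTypeR R => (EFin \o p) (- (x : R))).
  exact: (measurableT_comp mp (@measure_preservingN R).1).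
have pN0 (x : R) : (0 <= (EFin \o p) (- x)%R)%E by exact: p0.
apply: (@le_lt_trans _ _
  (\int[@lebesgue_measure R]_x
    (c^-1%:E * ((EFin \o p) x + (EFin \o p) (- (x : R))%R))))%E.
  apply: ge0_le_integral => //.
  - exact/measurable_EFinP.
  - by apply: measurable_funeM; exact: emeasurable_funD.
  - move=> x _; rewrite /= -EFinD -EFinM lee_fin ler_pdivlMl//.
    have [x0|x0] := leP 0 x.
      rewrite [p x]exponential_pdfE// mulNr ger0_norm// lerDl.
      by rewrite -lee_fin pN0.
    rewrite [p (- x)]exponential_pdfE ?oppr_ge0 ?(ltW x0)// mulNr.
    rewrite ltr0_norm// lerDr.
    by rewrite -lee_fin p0.
rewrite ge0_integralZl_EFin//; last 3 first.
- by move=> x _; exact: adde_ge0.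
- exact: emeasurable_funD.
- by rewrite invr_ge0 ltW.
rewrite ge0_integralD//.
rewrite (ge0_integral_preserving (@measure_preservingN R) mp p0).
rewrite [X in (_ * (X + X))%E](integral_exponential_pdf c0).
by rewrite -EFinD -EFinM ltry.
Qed.

(** * Integrability of the equilibrium on R^3 *)

Section space3.
Context {R : realType}.
Implicit Types v : space3 R.

Let B := (measurableTypeR R * measurableTypeR R * measurableTypeR R)%type.

Let measurable_borel (f : B -> measurableTypeR R) : measurable_fun setT f ->
  measurable_fun [set: space3 R] (f : space3 R -> R).
Proof.
move=> mf.
exact: (measurableT_comp mf
  (@measurable_completion_id _ _ _ (borel_measure3 R))).
Qed.

Lemma measurable_coord1 : measurable_fun setT (@coord1 R).
Proof.
by apply: measurable_borel; exact: measurableT_comp measurable_fst measurable_fst.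
Qed.

Lemma measurable_coord2 : measurable_fun setT (@coord2 R).
Proof.
by apply: measurable_borel; exact: measurableT_comp measurable_snd measurable_fst.
Qed.

Lemma measurable_coord3 : measurable_fun setT (@coord3 R).
Proof. by apply: measurable_borel; exact: measurable_snd. Qed.

Lemma measurable_sqnorm : measurable_fun setT (fun v => dot3 v v).
Proof.
apply: measurable_funD; last by apply: measurable_funM; exact: measurable_coord3.
apply: measurable_funD; apply: measurable_funM;
  solve [exact: measurable_coord1 | exact: measurable_coord2].
Qed.

Lemma measurable_enorm : measurable_fun setT (@enorm R).
Proof.
exact: (measurableT_comp (continuous_measurable_fun (@sqrt_continuous R))
  measurable_sqnorm).
Qed.

Lemma enorm_ge0 v : 0 <= enorm v. Proof. exact: sqrtr_ge0. Qed.

(** The Bose-Einstein profile, as a function on the whole line, has a pole at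
    |v| = -1.  As a function of |v|^2 through the total square root, it is
    continuous everywhere, hence measurable. *)
Lemma measurable_J0 s : measurable_fun setT (@J0 R s).
Proof.
case: s.
  have mexpN : measurable_fun setT (fun r : R => expR (- r)).
    by apply: measurableT_comp; [exact: measurable_expR|exact: oppr_measurable].
  exact: (measurableT_comp mexpN measurable_enorm).
have mBE : measurable_fun setT (fun q : R => (expR (1 + Num.sqrt q) - 1)^-1).
  apply: continuous_measurable_fun => q; apply: cvgV.
    by rewrite gt_eqF// subr_gt0 expR_gt1 ltr_pwDl// sqrtr_ge0.
  apply: cvgB; last exact: cvg_cst.
  apply: continuous_comp; last exact: continuous_expR.
  by apply: cvgD; [exact: cvg_cst|exact: sqrt_continuous].
exact: (measurableT_comp mBE measurable_sqnorm).
Qed.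

Lemma J0_ge0 s v : 0 <= J0 s v.
Proof.
case: s; rewrite /J0 ?expR_ge0// invr_ge0 subr_ge0 -expR0 ler_expR.
by rewrite addr_ge0 ?enorm_ge0.
Qed.

(** In the Bose-Einstein case the bound amounts to (e - 1) e^|v| >= 1. *)
Lemma J0_le s v : J0 s v <= expR (- enorm v).
Proof.
case: s => //=; rewrite expRN lef_pV2 ?posrE ?expR_gt0//; last first.
  by rewrite subr_gt0 expR_gt1 ltr_pwDl ?enorm_ge0.
rewrite expRD.
have e1 : 2 <= expR 1 :> R by have := expR_ge1Dx (1 : R); lra.
have e2 : 1 <= expR (enorm v) by rewrite -expR0 ler_expR enorm_ge0.
by nra.
Qed.

Lemma coord1_le v : `|coord1 v| <= enorm v.
Proof. by rewrite -sqrtr_sqr /enorm ler_wsqrtr// /dot3; nra. Qed.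

Lemma coord2_le v : `|coord2 v| <= enorm v.
Proof. by rewrite -sqrtr_sqr /enorm ler_wsqrtr// /dot3; nra. Qed.

Lemma coord3_le v : `|coord3 v| <= enorm v.
Proof. by rewrite -sqrtr_sqr /enorm ler_wsqrtr// /dot3; nra. Qed.

(** Half of the decay absorbs the weight, as 1 + u <= 2 e^(u/2).  The other
    half is split among the coordinates, |v| being at least their average
    absolute value: this is where the rate 1/6 comes from. *)
Lemma weighted_exp_le v : (1 + enorm v) * expR (- enorm v) <=
  2 * (expR (- (6^-1 * `|coord1 v|)) * expR (- (6^-1 * `|coord2 v|)) *
    expR (- (6^-1 * `|coord3 v|))).
Proof.
set u := enorm v; have u0 : 0 <= u := enorm_ge0 v.
apply: (@le_trans _ _ (2 * expR (- (u / 2)))).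
  have -> : - u = - (u / 2) - u / 2 by field.
  rewrite expRD mulrA ler_pM2r ?expR_gt0// [expR _]expRN.
  rewrite ler_pdivrMr ?expR_gt0//.
  by have := expR_ge1Dx (u / 2); lra.
rewrite ler_pM2l// -!expRD ler_expR.
have := coord1_le v; have := coord2_le v; have := coord3_le v.
by rewrite -/u; lra.
Qed.

Lemma integral_weighted_exp_lty :
  (\int[lebesgue_measure3 R]_v ((1 + enorm v) * expR (- enorm v))%:E < +oo)%E.
Proof.
pose g (x : measurableTypeR R) := (expR (- (6^-1 * `|x|)))%:E.
have mg : measurable_fun setT g.
  by apply/measurable_EFinP; exact: measurable_expR_abs.
have g0 x : (0 <= g x)%E by rewrite lee_fin expR_ge0.
have goo : (\int[lebesgue_measure]_x g x < +oo)%E.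
  exact: integral_expR_abs_lty.
have mgg : measurable_fun setT
    (fun z : measurableTypeR R * measurableTypeR R => g z.1 * g z.2)%E.
  by apply: emeasurable_funM; exact: measurableT_comp.
have mggg : measurable_fun setT (fun z : B => g z.1.1 * g z.1.2 * g z.2)%E.
  apply: emeasurable_funM; last exact: measurableT_comp.
  exact: (measurableT_comp mgg measurable_fst).
pose G (z : B) := (2%:E * (g z.1.1 * g z.1.2 * g z.2))%E.
have mG : measurable_fun setT G by exact: measurable_funeM.
have G0 z : (0 <= G z)%E by rewrite !mule_ge0.
apply: (@le_lt_trans _ _ (\int[lebesgue_measure3 R]_v G v)%E).
  apply: ge0_le_integral; first exact: measurableT.
  - by move=> v _; rewrite lee_fin mulr_ge0 ?expR_ge0// addr_ge0 ?enorm_ge0.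
  - apply/measurable_EFinP; apply: measurable_funM.
      by apply: measurable_funD; [exact: measurable_cst|exact: measurable_enorm].
    exact: (measurable_J0 Maxwell_Boltzmann).
  - exact: (measurableT_comp mG
      (@measurable_completion_id _ _ _ (borel_measure3 R))).
  - by move=> v _; rewrite /G /g -!EFinM lee_fin weighted_exp_le.
rewrite (ge0_integral_completion (borel_measure3 R) mG G0).
rewrite ge0_integralZl_EFin//; last by move=> z _; rewrite !mule_ge0.
have -> : (\int[borel_measure3 R]_z (g z.1.1 * g z.1.2 * g z.2) =
    \int[lebesgue_measure]_x g x * \int[lebesgue_measure]_x g x *
    \int[lebesgue_measure]_x g x)%E.
  exact: (ge0_integral_tensor3 lebesgue_measure lebesgue_measure
    lebesgue_measure mg mg mg g0 g0 g0).
have gfin : (\int[lebesgue_measure]_x g x)%E \is a fin_num.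
  by rewrite ge0_fin_numE// integral_ge0.
by rewrite -(fineK gfin) -!EFinM ltry.
Qed.

End space3.

(** * Moments of the relaxing distribution *)

Section moments.
Context {R : realType}.
Implicit Types (v : space3 R) (p f : space3 R -> R).
Local Notation mu := (lebesgue_measure3 R).

(** The weights of the moment conditions, 1, |v| and the coordinates, all have
    this property, so that number and energy control all the moments. *)
Definition linear_growth p : Prop :=
  measurable_fun setT p /\ forall v, `|p v| <= 1 + enorm v.

Lemma linear_growth_1 : linear_growth (fun=> 1).
Proof.
split=> [|v]; first exact: measurable_cst.
by rewrite normr1 lerDl enorm_ge0.
Qed.

Lemma linear_growth_enorm : linear_growth enorm.
Proof.
split=> [|v]; first exact: measurable_enorm.
by rewrite ger0_norm ?enorm_ge0// lerDr.
Qed.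

Lemma linear_growth_coord p : measurable_fun setT p ->
  (forall v, `|p v| <= enorm v) -> linear_growth p.
Proof.
move=> mp ple; split=> [|v]; first exact: mp.
by rewrite (le_trans (ple v))// lerDr.
Qed.

Lemma integrable_J0_moment s p : linear_growth p ->
  mu.-integrable setT (EFin \o (fun v => p v * J0 s v)).
Proof.
move=> [mp ple].
have mpJ : measurable_fun setT (EFin \o (fun v => p v * J0 s v)).
  apply/measurable_EFinP; apply: measurable_funM; first exact: mp.
  exact: measurable_J0.
have mE : measurable_fun setT
    (EFin \o (fun v => (1 + enorm v) * expR (- enorm v))).
  apply/measurable_EFinP; apply: measurable_funM.
    by apply: measurable_funD; [exact: measurable_cst|exact: measurable_enorm].
  exact: (measurable_J0 Maxwell_Boltzmann).
apply/integrableP; split; first exact: mpJ.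
apply: le_lt_trans (@integral_weighted_exp_lty R).
apply: ge0_le_integral.
- exact: measurableT.
- by move=> v _; exact: abse_ge0.
- by apply: (measurableT_comp _ mpJ); exact: abse_measurable.
- exact: mE.
- move=> v _; rewrite /= lee_fin normrM (ger0_norm (J0_ge0 s v)).
  by rewrite ler_pM ?J0_ge0 ?J0_le.
Qed.

Lemma ge0_integrable f : measurable_fun setT f -> (forall v, 0 <= f v) ->
  (\int[mu]_v (f v)%:E < +oo)%E -> mu.-integrable setT (EFin \o f).
Proof.
move=> mf f0 foo; apply/integrableP; split; first exact/measurable_EFinP.
rewrite (eq_integral (EFin \o f))// => v _.
by rewrite /= ger0_norm.
Qed.

(** The moment is dominated by the number and energy densities, since
    |p| f <= f + |v| f. *)
Lemma integrable_moment f p : measurable_fun setT f -> (forall v, 0 <= f v) ->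
  (\int[mu]_v (f v)%:E < +oo)%E -> (\int[mu]_v (enorm v * f v)%:E < +oo)%E ->
  linear_growth p -> mu.-integrable setT (EFin \o (fun v => p v * f v)).
Proof.
move=> mf f0 foo ffoo [mp ple].
have fi := ge0_integrable mf f0 foo.
have mef : measurable_fun setT (fun v => enorm v * f v).
  by apply: measurable_funM; [exact: measurable_enorm|exact: mf].
have ef0 v : 0 <= enorm v * f v by rewrite mulr_ge0 ?enorm_ge0.
have efi := ge0_integrable mef ef0 ffoo.
apply: (le_integrable measurableT _ _ (integrableD measurableT fi efi)).
  by apply/measurable_EFinP; apply: measurable_funM; [exact: mp|exact: mf].
move=> v _; rewrite /= lee_fin normrM (ger0_norm (f0 v)).
rewrite [leRHS]ger0_norm ?addr_ge0//.
by rewrite -{2}[f v]mul1r -mulrDl ler_wpM2r.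
Qed.

Definition reflection v : space3 R := (- coord1 v, - coord2 v, - coord3 v).

Lemma reflectionK : involutive reflection.
Proof.
by case=> -[x y] z; rewrite /reflection /coord1 /coord2 /coord3 /= !opprK.
Qed.

Lemma enorm_reflection v : enorm (reflection v) = enorm v.
Proof. by rewrite /enorm /dot3 /= !mulrNN. Qed.

Lemma measure_preserving_reflection : measure_preserving mu reflection.
Proof.
apply: (measure_preserving_completion (mu := borel_measure3 R) reflectionK).
have mN := @measure_preservingN R.
exact: (@measure_preserving_prod _ _ _ _ _
  (sigma_finite_product lebesgue_measure lebesgue_measure) lebesgue_measure
  _ _ (measure_preserving_prod mN mN) mN).
Qed.

(** J^0 - F(t) = e^(-t) (J^0 - F_0): the moments of the deviation from
    equilibrium only decay in time, and vanish if they vanish initially. *)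
Lemma zero_integral_relaxation s (F0 : space3 R -> R) (t : R) p :
  mu.-integrable setT (EFin \o (fun v => p v * J0 s v)) ->
  mu.-integrable setT (EFin \o (fun v => p v * F0 v)) ->
  (\int[mu]_v (p v * F0 v)%:E = \int[mu]_v (p v * J0 s v)%:E)%E ->
  zero_integral (fun v => p v *
    (J0 s v - (expR (- t) * F0 v + (1 - expR (- t)) * J0 s v))).
Proof.
move=> Ji Fi FJ.
pose k := expR (- t).
have Di : mu.-integrable setT
    (fun v => ((p v * J0 s v)%:E - (p v * F0 v)%:E))%E by exact: integrableB.
have E : EFin \o (fun v => p v * (J0 s v - (k * F0 v + (1 - k) * J0 s v))) =
    (fun v => k%:E * ((p v * J0 s v)%:E - (p v * F0 v)%:E))%E.
  by apply/funext => v /=; rewrite -EFinB -EFinM; congr EFin; ring.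
split; rewrite -/k.
  by rewrite E; exact: integrableZl.
rewrite -[LHS]/(integral mu setT (EFin \o (fun v =>
  p v * (J0 s v - (k * F0 v + (1 - k) * J0 s v))))) E.
rewrite (integralZl measurableT Di) (integralB_EFin measurableT Ji Fi) FJ.
rewrite subee ?mule0//.
exact: (integrable_fin_num measurableT Ji).
Qed.

End moments.

(** * Relaxation in time *)

(** Substitute h = r - t in the limit that defines the derivative. *)
Lemma cvg_difference_quotient (R : realType) (f : R -> R) (t l : R) :
  is_derive t 1 f l -> (f r - f t) / (r - t) @[r --> t^'] --> l.
Proof.
move=> dft.
have shift0 : (r - t) @[r --> t^'] --> (0 : R)^'.
  move=> A hA.
  have : \forall y \near (0 : R), y != 0 -> A y by exact: hA.
  rewrite (near_shift t) => hA'.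
  apply: filterS hA' => r; rewrite /= sub0r => hr rt.
  by apply: hr; rewrite subr_eq0.
have quot : h^-1 *: (f (h *: 1 + t) - f t) @[h --> 0^'] --> l.
  by rewrite -(@derive_val _ _ _ _ _ _ _ dft); exact: ex_derive.
rewrite (_ : (fun r => _) =
    (fun h => h^-1 *: (f (h *: 1 + t) - f t)) \o (fun r => r - t)).
  exact: cvg_comp shift0 quot.
apply/funext => r /=.
by rewrite /GRing.scale /= mulr1 subrK mulrC.
Qed.

(** The two-sided derivative exists, so the one-sided limit at t = 0 needs no
    separate treatment. *)
Lemma has_time_derivative_relaxation (R : realType) (a b t : R) :
  has_time_derivative (fun r => expR (- r) * a + (1 - expR (- r)) * b) t
    (b - (expR (- t) * a + (1 - expR (- t)) * b)).
Proof.
have dexp : is_derive t 1 (fun r : R => expR (- r)) (- expR (- t)).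
  have := is_derive1_comp (is_derive_expR (- t)) (is_deriveNid t 1).
  by rewrite mulrN1.
apply: cvg_within_filter.
have -> : b - (expR (- t) * a + (1 - expR (- t)) * b) =
    (a - b) * (- expR (- t)) by ring.
under eq_fun => r.
  rewrite (_ : _ / _ = (a - b) * ((expR (- r) - expR (- t)) / (r - t))).
  over.
  by rewrite mulrA; congr (_ / _); ring.
by apply: cvgM; [exact: cvg_cst|exact: cvg_difference_quotient].
Qed.

(** * The equilibrium as a Juttner distribution at rest *)

(** These values give mu_E / T_E = 0 and mu_E / T_E = -1, the constants in the
    exponents of J^0. *)
Definition rest_chemical_potential {R : realType} (s : statistics)
    (T : R) : R :=
  match s with Maxwell_Boltzmann => 0 | Bose_Einstein => - T end.

Lemma admissible_rest (R : realType) s (T : R) : 0 < T ->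
  admissible_parameters s (rest_chemical_potential s T) T.
Proof.
move=> T0; split=> //; case: s => //=.
by rewrite mulNr opprK divff ?ltr01// gt_eqF.
Qed.

(** At rest U_E^0 = 1, and the factor 1/a in v_0 = - |v| / a cancels against
    the temperature 1/a. *)
Lemma Juttner_rest (R : realType) s (a : R) (v : space3 R) : 0 < a ->
  Juttner s a (rest_chemical_potential s a^-1) a^-1 (0, 0, 0) v = J0 s v.
Proof.
move=> a0.
have pair : four_pairing a (0, 0, 0) v / a^-1 = - enorm v.
  rewrite /four_pairing /time_component /energy_component {1}/enorm /dot3 /=.
  rewrite !mul0r !addr0 sqrtr0 expr0n mulr0 addr0 sqrtr1.
  by field; rewrite gt_eqF.
have an0 : a^-1 != 0 by rewrite invr_eq0 gt_eqF.
case: s; rewrite /Juttner /J0 pair /=; first by rewrite mul0r add0r.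
by rewrite mulNr divff// !opprK.
Qed.

Lemma isotropic_J0 (R : realType) s : isotropic (@J0 R s).
Proof. by move=> v w vw; case: s; rewrite /J0 vw. Qed.

(** This makes the momentum of every isotropic distribution vanish. *)
Lemma integral_odd_moment (R : realType) (p f : space3 R -> R) :
  (forall v, p (reflection v) = - p v) -> isotropic f ->
  (lebesgue_measure3 R).-integrable setT (EFin \o (fun v => p v * f v)) ->
  (\int[lebesgue_measure3 R]_v (p v * f v)%:E = 0)%E.
Proof.
move=> p_odd f_iso.
apply: (integral_odd (@measure_preserving_reflection R)) => v.
by rewrite p_odd (f_iso _ _ (enorm_reflection v)) mulNr.
Qed.

Lemma integral_mul1 (R : realType) (f : space3 R -> R) :
  (\int[lebesgue_measure3 R]_v (1 * f v)%:E =
   \int[lebesgue_measure3 R]_v (f v)%:E)%E.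
Proof. by congr integral; apply/funext => v; rewrite mul1r. Qed.

Lemma isotropic_distribution_relaxation (R : realType) s (t : R)
    (F0 : space3 R -> R) : 0 <= t -> isotropic_distribution F0 ->
  isotropic_distribution
    (fun v => expR (- t) * F0 v + (1 - expR (- t)) * J0 s v).
Proof.
move=> t0 [mF0 F00 iF0]; split=> [|v|v w vw].
- apply: measurable_funD.
    by apply: measurable_funM; [exact: measurable_cst|exact: mF0].
  by apply: measurable_funM; [exact: measurable_cst|exact: measurable_J0].
- rewrite addr_ge0// mulr_ge0 ?expR_ge0 ?J0_ge0//.
  by rewrite subr_ge0 -expR0 ler_expR oppr_le0.
- by rewrite (iF0 _ _ vw) (isotropic_J0 s vw).
Qed.

Theorem theorem1p1 (R : realType) (s : statistics) (C t0 : R)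
    (hC : 0 < C) (ht0 : 0 < t0)
    (F0 : space3 R -> R) (hF0 : isotropic_distribution F0)
    (hnumber : (\int[lebesgue_measure3 R]_v (F0 v)%:E
              = \int[lebesgue_measure3 R]_v (J0 s v)%:E)%E)
    (henergy : (\int[lebesgue_measure3 R]_v (enorm v * F0 v)%:E
              = \int[lebesgue_measure3 R]_v (enorm v * J0 s v)%:E)%E) :
  solves_cauchy_problem s C t0 F0
    (fun t v => expR (- t) * F0 v + (1 - expR (- t)) * J0 s v).
Proof.
split=> [t tge0|v]; last by rewrite oppr0 expR0 mul1r subrr mul0r addr0.
split; first exact: isotropic_distribution_relaxation.
have [mF0 F00 iF0] := hF0.
set a := scale_factor C t0 t.
have a0 : 0 < a by rewrite mulr_gt0// sqrtr_gt0 ltr_wpDl.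
exists (rest_chemical_potential s a^-1), a^-1, (0, 0, 0).
have -> : Juttner s a (rest_chemical_potential s a^-1) a^-1 (0, 0, 0) = J0 s.
  by apply/funext => v; exact: Juttner_rest.
have J0moment := @integrable_J0_moment R s.
have number_lty : (\int[lebesgue_measure3 R]_v (F0 v)%:E < +oo)%E.
  rewrite hnumber -integral_mul1.
  exact: (integrable_lty measurableT (J0moment _ linear_growth_1)).
have energy_lty : (\int[lebesgue_measure3 R]_v (enorm v * F0 v)%:E < +oo)%E.
  rewrite henergy.
  exact: (integrable_lty measurableT (J0moment _ linear_growth_enorm)).
have F0moment (p : space3 R -> R) :=
  @integrable_moment R F0 p mF0 F00 number_lty energy_lty.
have moment (p : space3 R -> R) (p_lin : linear_growth p) :=
  @zero_integral_relaxation R s F0 t p (J0moment p p_lin) (F0moment p p_lin).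
have odd (p : space3 R -> R) (mp : measurable_fun setT p)
    (ple : forall v, `|p v| <= enorm v)
    (p_odd : forall v, p (reflection v) = - p v) :
    zero_integral (fun v => p v *
      (J0 s v - (expR (- t) * F0 v + (1 - expR (- t)) * J0 s v))).
  have p_lin := linear_growth_coord mp ple.
  apply: (moment p p_lin).
  rewrite (integral_odd_moment p_odd iF0 (F0moment p p_lin)).
  by rewrite (integral_odd_moment p_odd (@isotropic_J0 R s) (J0moment p p_lin)).
split; first by apply: admissible_rest; rewrite invr_gt0.
- split.
  + rewrite (_ : (fun v => _) = (fun v => 1 *
      (J0 s v - (expR (- t) * F0 v + (1 - expR (- t)) * J0 s v)))); last first.
      by apply/funext => v; rewrite mul1r.
    by apply: (moment _ linear_growth_1); rewrite !integral_mul1.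
  + exact: (moment _ linear_growth_enorm henergy).
  + exact: (odd _ measurable_coord1 (@coord1_le R) (fun=> erefl)).
  + exact: (odd _ measurable_coord2 (@coord2_le R) (fun=> erefl)).
  + exact: (odd _ measurable_coord3 (@coord3_le R) (fun=> erefl)).
- by move=> v; exact: has_time_derivative_relaxation.
Qed.
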